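(* Let $n\geq 1$ and let $G_n$ be the graph on $2n+1$ vertices obtained from the crown graph $H_{n,n}$ by adding a vertex adjacent to all other vertices. Then $G_n$ has the highest representation number among all comparability graphs on $2n+1$ vertices; that is, for every comparability graph $G$ on $2n+1$ vertices, $\mathcal{R}(G)\leq \mathcal{R}(G_n)$.
   Context: All graphs are finite, simple and undirected. Two distinct letters $x,y$ alternate in a word $w$ if deleting from $w$ all letters other than $x$ and $y$ yields a word of the form $xyxy\cdots$ or $yxyx\cdots$ (of even or odd length). A word $w$ over the alphabet $V$, containing each letter of $V$ at least once, represents the graph $G=(V,E)$ if for all distinct $x,y\in V$, the letters $x$ and $y$ alternate in $w$ if and only if $xy\in E$. A word is $k$-uniform if each letter of $V$ occurs in it exactly $k$ times. A graph is $k$-representable if it is represented by some $k$-uniform word. The representation number $\mathcal{R}(G)$ is the least $k\geq 1$ such that $G$ is $k$-representable, and $\mathcal{R}(G)=\infty$ if no such $k$ exists. The crown graph $H_{n,n}$ is the graph obtained from the complete bipartite graph $K_{n,n}$ by removing the edges of a perfect matching. A comparability graph is a graph that admits a transitive orientation, i.e. an orientation of its edges such that $u\rightarrow v$ and $v\rightarrow z$ imply $u\rightarrow z$. *)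

(* Defs.v *)
From mathcomp Require Import all_boot.
From mathcomp Require Import boolp.

Set Implicit Arguments.
Unset Strict Implicit.
Unset Printing Implicit Defensive.

Record sgraph := SGraph {
  vertex :> finType;
  edge : rel vertex;
  edge_sym : symmetric edge;
  edge_irrefl : irreflexive edge
}.

Section Words.
Variable V : finType.
Implicit Types (x y : V) (w : seq V) (k : nat).

Definition altword x y m : seq V := mkseq (fun i => if odd i then y else x) m.

Definition restrict x y w : seq V := [seq z <- w | (z == x) || (z == y)].

Definition alternate x y w : bool :=
  let u := restrict x y w in
  (u == altword x y (size u)) || (u == altword y x (size u)).

Definition uniform k w : Prop := forall x, count_mem x w = k.
End Words.

Section Representation.
Variable G : sgraph.

Definition represents (w : seq G) : Prop :=
  (forall x : G, x \in w) /\
  (forall x y : G, x != y -> alternate x y w = edge x y).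

Definition k_representable (k : nat) : Prop :=
  exists w : seq G, uniform k w /\ represents w.

Lemma repnum_boolP :
  (exists k, 0 < k /\ k_representable k) ->
  exists k, (0 < k) && `[< k_representable k >].
Proof. by case=> k [k_gt0 Gk]; exists k; rewrite k_gt0; apply/asboolP. Qed.

(* [None] stands for an infinite representation number. *)
Definition repnum : option nat :=
  match pselect (exists k, 0 < k /\ k_representable k) with
  | left Gk => Some (ex_minn (repnum_boolP Gk))
  | right _ => None
  end.

Definition orientation (o : rel G) : Prop :=
  (forall x y, edge x y = o x y || o y x) /\
  (forall x y, ~~ (o x y && o y x)).

Definition comparability : Prop :=
  exists o : rel G, orientation o /\ transitive o.
End Representation.

Definition le_repnum (a b : option nat) : bool :=
  match a, b with
  | _, None => true
  | None, Some _ => false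
  | Some k, Some l => k <= l
  end.

(* The removed perfect matching of K_{n,n} pairs [inl i] with [inr i]. *)
Definition crown_edge (n : nat) (u v : 'I_n + 'I_n) : bool :=
  match u, v with
  | inl i, inr j | inr i, inl j => i != j
  | _, _ => false
  end.

Lemma crown_edge_sym n : symmetric (@crown_edge n).
Proof. by move=> [i|i] [j|j] //=; rewrite eq_sym. Qed.

Lemma crown_edge_irrefl n : irreflexive (@crown_edge n).
Proof. by case. Qed.

Definition crown (n : nat) : sgraph :=
  SGraph (@crown_edge_sym n) (@crown_edge_irrefl n).

(* [None] is the added vertex. *)
Definition cone_edge (G : sgraph) (u v : option G) : bool :=
  match u, v with
  | Some x, Some y => edge x y
  | None, None => false
  | _, _ => true
  end.

Lemma cone_edge_sym (G : sgraph) : symmetric (@cone_edge G).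
Proof. by move=> [x|] [y|] //=; rewrite edge_sym. Qed.

Lemma cone_edge_irrefl (G : sgraph) : irreflexive (@cone_edge G).
Proof. by case=> [x|] //=; rewrite edge_irrefl. Qed.

Definition cone (G : sgraph) : sgraph :=
  SGraph (@cone_edge_sym G) (@cone_edge_irrefl G).

Lemma card_cone_crown n : #|cone (crown n)| = 2 * n + 1.
Proof. by rewrite card_option card_sum card_ord addn1 mul2n addnn. Qed.

(* Main.v *)
Require Import Defs.
From mathcomp Require Import all_boot.
From mathcomp Require Import boolp zify.

(* In a uniform word for a cone, rotated so that the apex comes first, the
   t-th occurrences of the other letters between consecutive apices define
   linear orders, and two letters are adjacent iff all these orders agree on
   them; conversely, concatenating the orders of a realizer of a transitive
   orientation represents its graph. For the cone over the crown the orders all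
   place one side below the other, up to the matched pairs, and each of them
   reverses at most one matched pair, so at least n are needed (and at least 2,
   as the graph is not complete). For the upper bound, Hiraguchi's theorem:
   if A is a maximum antichain of P, then dim P <= |A| by Dilworth's theorem
   (proved with Galvin's argument) and dim P <= max(2, |P \ A|) by one-point
   removal, so dim P <= max(2, |P| / 2). *)

(** * Order dimension through rank functions *)

Section Dimension.
Set Implicit Arguments.
Unset Strict Implicit.
Variable T : finType.
Implicit Types (o : rel T) (S A B D : {set T}) (x y a b u z : T).

Definition incomp o x y := [&& x != y, ~~ o x y & ~~ o y x].

Definition antichain o A := [forall x in A, forall y in A, ~~ o x y].

Lemma antichainP o A :
  reflect {in A &, forall x y, ~~ o x y} (antichain o A).
Proof.
apply: (iffP forall_inP) => [AP x y xA yA | AP x xA].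
  by move/forall_inP: (AP x xA); apply.
by apply/forall_inP => y yA; apply: AP.
Qed.

(* Rank functions [F t] may have ties: breaking these arbitrarily gives linear
   extensions. Asking monotonicity also for [t >= k] is harmless. *)
Definition dim_le o S k := exists F : nat -> T -> nat,
  (forall t, {in S &, forall x y, o x y -> F t x < F t y}) /\
  {in S &, forall x y, incomp o x y -> exists2 t, t < k & F t x < F t y}.

Lemma dim_le_mono o S k l : k <= l -> dim_le o S k -> dim_le o S l.
Proof.
move=> kl [F [F1 F2]]; exists F; split=> // x y xS yS xy.
by have [t tk Ft] := F2 x y xS yS xy; exists t => //; apply: leq_trans tk kl.
Qed.

Lemma dim_le_dual o S k : dim_le o S k -> dim_le (fun x y => o y x) S k.
Proof.
move=> [F [F1 F2]]; exists (fun t x => \max_z F t z - F t x).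
have Fm t x : F t x <= \max_z F t z by apply: leq_bigmax.
split=> [t x y xS yS yx | x y xS yS xy].
  by have := F1 t y x yS xS yx; have := Fm t x; have := Fm t y; lia.
have yx : incomp o y x.
  by move: xy; rewrite /incomp eq_sym.
have [t tk Ft] := F2 y x yS xS yx; exists t => //.
by have := Fm t x; have := Fm t y; lia.
Qed.

(* Ties between the two keys are broken by opposite enumerations of [T]. *)
Lemma dim_le2_keys o S (f g : T -> nat) :
  {in S &, forall x y, o x y -> f x < f y /\ g x < g y} ->
  {in S &, forall x y, incomp o x y ->
     [|| f x < f y, g x < g y | (f x == f y) && (g x == g y)]} ->
  dim_le o S 2.
Proof.
move=> mono inc; pose N := #|T|; pose r x : nat := enum_rank x.
have rN x : r x < N by apply: ltn_ord.
(* Base [N.+1] makes the first key dominate, since the tie-breaking summand is at most [N]. *)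
have lexlt (p q i j : nat) : p < q -> i <= N -> p * N.+1 + i < q * N.+1 + j.
  by move=> pq iN; nia.
exists (fun t x => if t == 0 then f x * N.+1 + r x else g x * N.+1 + (N - r x)).
split=> [t x y xS yS xy | x y xS yS xy].
  have [fxy gxy] := mono x y xS yS xy.
  by case: eqP => _; apply: lexlt => //; have := rN x; lia.
case/or3P: (inc x y xS yS xy) => [fxy | gxy | /andP[/eqP fxy /eqP gxy]].
- by exists 0 => //=; apply: lexlt => //; have := rN x; lia.
- by exists 1 => //=; apply: lexlt => //; have := rN x; lia.
have rxy : r x != r y.
  case/and3P: xy => xy _ _; apply: contra xy => /eqP/ord_inj/enum_rank_inj ->.
  by [].
have := rN x; have := rN y; case: (ltngtP (r x) (r y)) rxy => // rxy _ ? ?.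
  by exists 0 => //=; rewrite fxy ltn_add2l.
by exists 1 => //=; rewrite gxy ltn_add2l; lia.
Qed.

(** * One-point removal and Dilworth's theorem *)

Section Order.
Variable o : rel T.
Hypotheses (o_irr : irreflexive o) (o_tr : transitive o).

Lemma o_asym x y : o x y -> o y x = false.
Proof. by move=> xy; apply/negP => /(o_tr xy); rewrite o_irr. Qed.

Definition height x := #|[set z | o z x]|.

Lemma ltn_height x y : o x y -> height x < height y.
Proof.
move=> xy; apply: proper_card; apply/properP; split.
  by apply/subsetP => z; rewrite !inE => /o_tr; apply.
by exists x; rewrite !inE ?o_irr.
Qed.

Lemma incompPn x y : ~~ incomp o x y -> [\/ x = y, o x y | o y x].
Proof.
rewrite /incomp; case: (eqVneq x y) => [-> _|_]; first exact: Or31.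
by case xy: (o x y); case yx: (o y x) => // _;
   [exact: Or32 | exact: Or32 | exact: Or33].
Qed.

(** The extension [F 0] is replaced by two: [M1] puts [x] as high as possible and [M2] as low as
    possible, which separates [x] from every point incomparable to it. An incomparable pair ordered
    by [F 0] keeps its order in [M1] unless its first point is above [x], and in that case keeps it
    in [M2]. *)
Lemma dim_le_add1 S k x :
  0 < k -> dim_le o S k -> dim_le o (x |: S) k.+1.
Proof.
move=> k_gt0 [F [F1 F2]].
have [xS|xS] := boolP (x \in S).
  have -> : x |: S = S by apply/setUidPr; rewrite sub1set.
  by apply: dim_le_mono (leqnSn k) _; exists F.
pose N := (\max_z F 0 z).+1.
have FN z : F 0 z < N by rewrite ltnS; apply: leq_bigmax.
pose M1 a := if a == x then N else if o x a then N.+1 + F 0 a else F 0 a.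
pose M2 a := if a == x then N else if o a x then F 0 a else N.+1 + F 0 a.
(* Doubling leaves even values free, and [x] takes the one just above all points below it. If there
   are none, the empty maximum 0 is below all the odd values. *)
pose E t a := if a == x then \max_(z in S | o z x) (2 * F t z + 2)
              else 2 * F t a + 1.
exists (fun t a => if t == 0 then M1 a else if t == k then M2 a else E t a).
have inS a : a \in x |: S -> a != x -> a \in S.
  by rewrite in_setU1 => /orP[->|].
split=> [t a b aS bS ab | a b aS bS ab].
  have [ax|ax] := eqVneq a x; have [bx|bx] := eqVneq b x.
  - by move: ab; rewrite ax bx o_irr.
  - have bS' := inS b bS bx; rewrite ax in ab.
    rewrite /M1 /M2 /E ax eqxx (negbTE bx) ab (o_asym ab).
    case: eqP => _; first by lia.
    case: eqP => _; first by lia.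
    apply: leq_ltn_trans (_ : 2 * F t b < _); last by rewrite addn1.
    apply/bigmax_leqP => z /andP[zS zx].
    by have := F1 t z b zS bS' (o_tr zx ab); lia.
  - have aS' := inS a aS ax; rewrite bx in ab.
    rewrite /M1 /M2 /E bx eqxx (negbTE ax) ab (o_asym ab).
    case: eqP => _; first exact: FN.
    case: eqP => _; first exact: FN.
    apply: leq_trans (_ : 2 * F t a + 2 <= _); first by lia.
    apply: (@leq_bigmax_cond _ (fun z => (z \in S) && o z x)
             (fun z => 2 * F t z + 2)).
    by rewrite aS' ab.
  have aS' := inS a aS ax; have bS' := inS b bS bx.
  rewrite /M1 /M2 /E (negbTE ax) (negbTE bx).
  have Fab s := F1 s a b aS' bS' ab.
  case: eqP => _.
    have := Fab 0; case: (boolP (o x a)) => [xa|_].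
      by rewrite (o_tr xa ab) ltn_add2l.
    by case: ifP => _ //; lia.
  case: eqP => _; last by have := Fab t; lia.
  have := Fab 0; case: (boolP (o b x)) => [bx'|_].
    by rewrite (o_tr ab bx').
  by case: ifP => _; lia.
case/and3P: (ab) => nab oab oba.
have [ax|ax] := eqVneq a x.
  exists k => //; rewrite (gtn_eqF k_gt0) eqxx /M2.
  have bx : b != x by rewrite -ax eq_sym.
  by rewrite ax eqxx (negbTE bx) -ax (negbTE oba); lia.
have [bx|bx] := eqVneq b x.
  by exists 0 => //=; rewrite /M1 bx eqxx (negbTE ax) -bx (negbTE oba).
have aS' := inS a aS ax; have bS' := inS b bS bx.
have [t tk Ft] := F2 a b aS' bS' ab.
have [t0|t0] := eqVneq t 0; last first.
  exists t; first exact: ltnW.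
  by rewrite (negbTE t0) (ltn_eqF tk) /E (negbTE ax) (negbTE bx); lia.
rewrite t0 in Ft.
have [xa|xa] := boolP (o x a); last first.
  exists 0 => //=; rewrite /M1 (negbTE ax) (negbTE bx) (negbTE xa).
  by case: ifP => _ //; lia.
exists k => //; rewrite (gtn_eqF k_gt0) eqxx /M2 (negbTE ax) (negbTE bx).
have -> : o b x = false by apply/negP => /o_tr/(_ xa); apply/negP.
by case: ifP => _; lia.
Qed.

(* [M] collects, in each chain of a minimal chain cover of [S :\ a], the topmost
   point that lies on a maximum antichain. *)
Lemma dilworth S : exists A (c : T -> nat),
  [/\ A \subset S, antichain o A, {in S, forall x, c x < #|A|} &
      {in S &, forall x y, c x = c y -> ~~ incomp o x y}].
Proof.
move: {2}#|S| (leqnn #|S|) => m; elim: m S => [|m IHm] S Sm.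
  have S0 x : x \in S = false.
    by move: Sm; rewrite leqn0 cards_eq0 => /eqP ->; rewrite inE.
  exists set0, (fun=> 0); split; rewrite ?sub0set //.
  - by apply/antichainP => x y; rewrite inE.
  - by move=> x; rewrite S0.
  - by move=> x y; rewrite S0.
have [->|[a0 a0S]] := set_0Vmem S; first by apply: IHm; rewrite cards0.
have [a aS amax] : exists2 a, a \in S & {in S, forall b, ~~ o a b}.
  case: (@arg_maxnP _ a0 (mem S) height a0S) => a aS amax; exists a => // b bS.
  by apply/negP => /ltn_height; rewrite ltnNge; have := amax b bS; rewrite /= => ->.
pose S' := S :\ a.
have S'S x : x \in S' -> x \in S by rewrite !inE => /andP[].
have card_lt (R : {set T}) : R \subset S' -> #|R| <= m.
  by move/subset_leq_card; move: Sm; rewrite (cardsD1 a S) aS /S'; lia.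
have [A0 [c [A0S A0P cA0 cP]]] := IHm S' (card_lt _ (subxx _)).
set k := #|A0| in cA0.
(* A chain meets an antichain at most once, so [c] is injective on antichains, and on those with [k]
   points it takes every value below [k]. *)
have c_inj B : B \subset S' -> antichain o B -> {in B &, injective c}.
  move=> /subsetP BS /antichainP BP x y xB yB cxy.
  case: (incompPn (cP x y (BS x xB) (BS y yB) cxy)) => // oxy.
    by have := BP x y xB yB; rewrite oxy.
  by have := BP y x yB xB; rewrite oxy.
have mapc B : B \subset S' -> antichain o B ->
    uniq (map c (enum B)) /\ {subset map c (enum B) <= iota 0 k}.
  move=> BS BP; split.
    rewrite map_inj_in_uniq ?enum_uniq // => x y; rewrite !mem_enum.
    exact: c_inj BS BP x y.
  move=> i /mapP[x]; rewrite mem_enum => xB ->; rewrite mem_iota /=.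
  by apply: cA0; apply: (subsetP BS).
have c_le B : B \subset S' -> antichain o B -> #|B| <= k.
  move=> BS BP; have [uB sB] := mapc B BS BP.
  by have := uniq_leq_size uB sB; rewrite size_map size_iota -cardE.
have c_surj B i : B \subset S' -> antichain o B -> #|B| = k -> i < k ->
    exists2 y, y \in B & c y = i.
  move=> BS BP Bk ik; have [uB sB] := mapc B BS BP.
  have sz : size (iota 0 k) <= size (map c (enum B)).
    by rewrite size_map size_iota -cardE Bk.
  have [_ eqB] := uniq_min_size uB sB sz.
  have : i \in map c (enum B) by rewrite eqB mem_iota.
  by case/mapP => y; rewrite mem_enum => yB ->; exists y.
pose good y := [exists B : {set T},
  [&& B \subset S', antichain o B, #|B| == k & y \in B]].
have goodS y : good y -> y \in S'.
  by case/existsP => B /and4P[/subsetP BS _ _ /BS].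
pose M := [set y | good y &&
  [forall z, (c z == c y) && good z ==> ~~ o y z]].
have MS y : y \in M -> y \in S' by rewrite inE => /andP[/goodS].
have Mtop y z : y \in M -> c z = c y -> good z -> ~~ o y z.
  rewrite inE => /andP[_ /forallP/(_ z)/implyP yM] czy zg; apply: yM.
  by rewrite czy eqxx zg.
(* If [u] were below [v], a maximum antichain through [v] would meet the chain of [u] in a good
   point [y]. As [u] is topmost, [y] is at most [u], hence below [v]: a contradiction. *)
have M_anti : antichain o M.
  apply/antichainP => u v uM vM; apply/negP => uv.
  have : good v by move: vM; rewrite inE => /andP[].
  case/existsP => B /and4P[BS BP /eqP Bk vB].
  have [y yB cy] := c_surj B (c u) BS BP Bk (cA0 u (MS u uM)).
  have yg : good y by apply/existsP; exists B; rewrite BS BP Bk eqxx yB.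
  have BPyv := antichainP _ _ BP y v yB vB.
  case: (incompPn (cP y u (goodS y yg) (MS u uM) cy)) => [yu|yu|uy].
  - by move: BPyv; rewrite yu uv.
  - by move: BPyv; rewrite (o_tr yu uv).
  - by have := Mtop u y uM cy yg; rewrite uy.
have M_card : k <= #|M|.
  have sub : {subset iota 0 k <= map c (enum M)}.
    move=> i; rewrite mem_iota /= => ik.
    have [y yA cy] := c_surj A0 i A0S A0P erefl ik.
    have yg : good y && (c y == i).
      by rewrite cy eqxx andbT; apply/existsP; exists A0; rewrite A0S A0P yA eqxx.
    case: (@arg_maxnP _ y (fun y => good y && (c y == i)) height yg).
    move=> u /andP[ug /eqP cu] umax; apply/mapP; exists u => //.
    rewrite mem_enum inE ug /=; apply/forallP => z; apply/implyP.
    rewrite cu => /andP[cz zg]; apply/negP => /ltn_height.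
    by rewrite ltnNge; have := umax z; rewrite /= zg cz => /(_ isT) ->.
  by have := uniq_leq_size (iota_uniq 0 k) sub; rewrite size_map size_iota -cardE.
have [/existsP[u /andP[uM ua]]|noM] := boolP [exists u, (u \in M) && o u a].
  (* [K] is a chain: [a] on top of the part of the chain of [u] up to [u]. *)
  pose K := [set z in S | (z == a) || ((c z == c u) && ((z == u) || o z u))].
  have S2S : S :\: K \subset S'.
    apply/subsetP => z; rewrite !inE negb_and => /andP[/orP[/negbTE -> //|]].
    by rewrite negb_or => /andP[-> _] ->.
  have [A2 [c2 [A2S A2P cA2 c2P]]] := IHm (S :\: K) (card_lt _ S2S).
  have A2S' := subset_trans A2S S2S.
  (* An antichain with [k] points avoiding [K] would meet the chain of [u] in a good point strictly
     above [u]. So fewer than [k] chains cover the rest, and [K] takes the free index [#|A2|]. *)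
  have k2 : #|A2| < k.
    rewrite ltn_neqAle c_le // andbT; apply/eqP => A2k.
    have [y yA cy] := c_surj A2 (c u) A2S' A2P A2k (cA0 u (MS u uM)).
    have yg : good y by apply/existsP; exists A2; rewrite A2S' A2P A2k eqxx yA.
    have := subsetP A2S y yA; rewrite !inE cy eqxx /= => /andP[yK yS].
    move: yK; rewrite yS /= !negb_or => /and3P[_ yu oyu].
    case: (incompPn (cP y u (goodS y yg) (MS u uM) cy)) => [eyu|eyu|uy].
    + by rewrite eyu eqxx in yu.
    + by rewrite eyu in oyu.
    + by have := Mtop u y uM cy yg; rewrite uy.
  have Ka z : z \in K -> z = a \/ [/\ z \in S', c z = c u & o z a].
    rewrite inE => /andP[zS].
    have [-> _|za /= /andP[/eqP zu]] := eqVneq z a; first by left.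
    move=> zu'; right; split=> //; first by rewrite !inE za.
    by case/orP: zu' => [/eqP -> //|zu']; apply: o_tr zu' ua.
  exists A0, (fun x => if x \in K then #|A2| else c2 x); split=> //.
  - by apply: subset_trans A0S _; apply/subsetP.
  - move=> x xS; case: ifP => xK //; apply: ltn_trans k2.
    by apply: cA2; rewrite inE xK xS.
  - move=> x y xS yS; case: ifP => xK; case: ifP => yK.
    + move=> _; rewrite /incomp.
      case: (Ka x xK) (Ka y yK) => [->|[xS' cx xa]] [->|[yS' cy ya]].
      * by rewrite eqxx.
      * by rewrite ya !andbF.
      * by rewrite xa !andbF.
      * by apply: cP; rewrite // cx cy.
    + have : c2 y < #|A2| by apply: cA2; rewrite inE yK yS.
      by move=> lt eq; rewrite -eq ltnn in lt.
    + have : c2 x < #|A2| by apply: cA2; rewrite inE xK xS.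
      by move=> lt eq; rewrite eq ltnn in lt.
    + by apply: c2P; rewrite inE ?xK ?yK.
(* Now the maximal point [a] is incomparable to all of [M], so adding it gives an antichain with
   more than [k] points, and [a] forms a new chain with index [k]. *)
have aM : a \notin M by apply/negP => /MS; rewrite !inE eqxx.
exists (a |: M), (fun x => if x == a then k else c x); split.
- apply/subsetP => x; rewrite in_setU1 => /orP[/eqP -> //|/MS]; exact: S'S.
- have Ma u : u \in M -> ~~ o u a.
    by move=> uM; move/existsPn: noM => /(_ u); rewrite uM.
  apply/antichainP => x y; rewrite !in_setU1.
  move=> /orP[/eqP ->|xM] /orP[/eqP ->|yM]; rewrite ?o_irr //.
  + by apply: amax; apply/S'S/MS.
  + exact: Ma.
  + exact: (antichainP _ _ M_anti).
- move=> x xS; rewrite cardsU1 aM add1n ltnS; case: eqP => // /eqP xa.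
  by apply/ltnW/(leq_trans (cA0 x _) M_card); rewrite !inE xa.
- have lt z : z \in S -> z != a -> c z < k.
    by move=> zS za; apply: cA0; rewrite !inE za.
  move=> x y xS yS; case: (eqVneq x a) => [->|xa]; case: (eqVneq y a) => [->|ya].
  + by rewrite /incomp eqxx.
  + by move=> e; have := lt y yS ya; rewrite -e ltnn.
  + by move=> e; have := lt x xS xa; rewrite e ltnn.
  + by apply: cP; rewrite !inE ?xa ?ya.
Qed.

(** Extension [t] sorts points by the number of members of chain [t] weakly below them, then by
    height. If [y] is in chain [t] and incomparable to [x], all members weakly below [x] are below
    [y], and [y] itself counts once more for [y]; so [x] comes first. *)
Lemma dim_le_chains S k (c : T -> nat) :
  {in S, forall x, c x < k} ->
  {in S &, forall x y, c x = c y -> ~~ incomp o x y} -> dim_le o S k.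
Proof.
move=> ck cP; pose N := #|T|.
have hN x : height x <= N by apply: max_card.
pose C t y := [set x in S | (c x == t) && ((x == y) || o x y)].
have lexlt (p q i j : nat) : p < q -> i <= N -> p * N.+1 + i < q * N.+1 + j.
  by move=> pq iN; nia.
exists (fun t y => #|C t y| * N.+1 + height y); split=> [t x y _ _ xy | x y xS yS].
  have sub : C t x \subset C t y.
    apply/subsetP => z; rewrite !inE => /and3P[-> -> /orP[/eqP ->|zx]] /=.
      by rewrite xy orbT.
    by rewrite (o_tr zx xy) orbT.
  have := ltn_height xy; have := subset_leq_card sub; nia.
case/and3P => nxy oxy oyx; exists (c y); first exact: ck.
apply: lexlt => //; apply: proper_card; apply/properP; split.
  apply/subsetP => z; rewrite !inE => /and3P[zS /eqP zy zx].
  rewrite zS zy eqxx /=; case: (incompPn (cP z y zS yS zy)) => [->|->|yz].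
  - by rewrite eqxx.
  - by rewrite orbT.
  - case/orP: zx => [/eqP zx|/(o_tr yz) yx]; first by rewrite -zx yz in oyx.
    by rewrite yx in oyx.
exists y; first by rewrite !inE yS !eqxx.
by rewrite !inE yS eqxx /= eq_sym negb_or nxy.
Qed.

End Order.

(* The points of [S] other than [x], [y] form an antichain; the keys [f], [g]
   only depend on how a point compares with [x] and [y]. *)
Lemma dim_le2_up_up o S x y :
  irreflexive o -> transitive o -> ~~ o y x ->
  {in S &, forall a b, o a b -> b = x \/ b = y} -> dim_le o S 2.
Proof.
move=> o_irr o_tr nyx up.
(* Order of [f]: below [x] only, below both, [x], below [y] only, [y], below neither. Order of [g]:
   below neither, below [y] only, below both, [y], below [x] only, [x]; but [y] moves to the top if
   [o x y]. *)
pose f a := if a == x then 3 else if a == y then 5 else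
  if o a x then (if o a y then 2 else 1) else if o a y then 4 else 6.
pose g a := if a == x then 5 else if a == y then (if o x y then 6 else 3) else
  if o a x then (if o a y then 2 else 4) else if o a y then 1 else 0.
apply: (@dim_le2_keys o S f g) => a b aS bS; rewrite /f /g.
  move=> ab; move: (@o_tr x a y).
  case: (up a b aS bS ab) => e; subst b; rewrite ab eqxx.
    have [eax|_] := eqVneq a x; first by rewrite eax o_irr in ab.
    have [eay|_] := eqVneq a y; first by rewrite -eay ab in nyx.
    by case: (o a y); case: (o x y) => // /(_ isT isT).
  have [eyx _|nyx' _] := eqVneq y x.
    subst y; rewrite ab; have [eax|_] := eqVneq a x; last by [].

    by rewrite eax o_irr in ab.
  have [eax|_] := eqVneq a x; first by rewrite -eax ab.
  have [eay|_] := eqVneq a y; first by rewrite eay o_irr in ab.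
  by case: (o a x); case: (o x y).
have ax := @o_tr x a y; have bx := @o_tr x b y.
move: ax bx nyx; rewrite /incomp.
have [->|nax] := eqVneq a x; have [->|nbx] := eqVneq b x; rewrite ?eqxx //=;
  have [eay|nay] := eqVneq a y; have [eby|nby] := eqVneq b y;
  subst; rewrite ?eqxx ?o_irr //=;
repeat match goal with |- context [o ?u ?v] => case: (o u v) => //= end;
  rewrite ?andbF // => h1 h2;
  first [by [] | by have := h1 isT isT | by have := h2 isT isT].
Qed.

(** The same device when other points can only lie below [x] or above [y]. *)
Lemma dim_le2_up_down o S x y :
  irreflexive o -> transitive o -> x != y ->
  {in S &, forall a b, o a b -> b = x \/ a = y} -> dim_le o S 2.
Proof.
move=> o_irr o_tr nxy ud.
(* Order of [f]: below neither nor above, below [x] only, [y], between, [x], above [y] only; if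
   [o y x] fails, [x] and [y] swap and no point is between. Order of [g]: [y], above [y] only,
   between, below [x] only, [x], the rest. *)
pose f a := if a == x then (if o y x then 4 else 2) else
  if a == y then (if o y x then 2 else 4) else
  if o a x then (if o y a then 3 else 1) else if o y a then 5 else 0.
pose g a := if a == x then 4 else if a == y then 0 else
  if o a x then (if o y a then 2 else 3) else if o y a then 1 else 5.
apply: (@dim_le2_keys o S f g) => a b aS bS; rewrite /f /g.
  move=> ab; case: (ud a b aS bS ab) => e; subst.
    have [eax|nax] := eqVneq a x; first by rewrite eax o_irr in ab.
    rewrite eqxx ab; have [eay|nay] := eqVneq a y; first by rewrite -eay ab.
    have := @o_tr a y x; rewrite ab.
    by case: (o y a); case: (o y x) => // /(_ isT isT).
  rewrite eq_sym (negbTE nxy) eqxx ab.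
  have [ebx|nbx] := eqVneq b x; first by rewrite -ebx ab.
  have [eby|nby] := eqVneq b y; first by rewrite eby o_irr in ab.
  have := @o_tr b y x ab.
  by case: (o b x); case: (o y x) => // /(_ isT).
have := @o_tr a y x; have := @o_tr b y x.
rewrite /incomp.
have [->|nax] := eqVneq a x; have [->|nbx] := eqVneq b x; rewrite ?eqxx //=;
  have [eay|nay] := eqVneq a y; have [eby|nby] := eqVneq b y;
  subst; rewrite ?eqxx ?o_irr //=;
repeat match goal with |- context [o ?u ?v] => case: (o u v) => //= end;
  rewrite ?andbF // => h1 h2;
  first [by [] | by have := h1 isT isT | by have := h2 isT isT].
Qed.

(** By transitivity, [x] cannot have third points both above and below it, and likewise [y]. The
    up-up and mixed cases are the two preceding lemmas; down-down is dual to up-up. *)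
Lemma dim_le2_antichain_add2 o S x y :
  irreflexive o -> transitive o ->
  {in S &, forall a b, o a b -> [\/ a = x, a = y, b = x | b = y]} ->
  dim_le o S 2.
Proof.
have up_up (r : rel T) (R : {set T}) u v : irreflexive r -> transitive r ->
    {in R &, forall a b, r a b -> b = u \/ b = v} -> dim_le r R 2.
  move=> r_irr r_tr rP; have [vu|vu] := boolP (r v u).
    apply: (@dim_le2_up_up _ _ v u r_irr r_tr); first by rewrite (o_asym r_irr).
    by move=> a b aR bR ab; case: (rP a b aR bR ab); [right | left].
  exact: (@dim_le2_up_up _ _ u v r_irr r_tr vu).
move=> o_irr o_tr oP.
pose up u v := {in S, forall a, o u a -> a = v}.
pose dn u v := {in S, forall a, o a u -> a = v}.
have up_dn u v : {in S &, forall a b, o a b -> [\/ a = u, a = v, b = u | b = v]} ->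
    up u v \/ dn u v.
  move=> uvP; have [|nup] := EM (up u v); [by left | right=> a aS au].
  apply: contrapT => nav; apply: nup => b bS ub.
  case: (uvP a b aS bS (o_tr _ _ _ au ub)) => // e; subst.
    by rewrite o_irr in au.
  by rewrite o_irr in ub.
have up_up_o u v : {in S &, forall a b, o a b -> [\/ a = u, a = v, b = u | b = v]} ->
    up u v -> up v u -> dim_le o S 2.
  move=> uvP uv vu; apply: (up_up o S u v) => // a b aS bS ab.
  case: (uvP a b aS bS ab) => e; subst; [right|left|left|right] => //.
    exact: uv.
  exact: vu.
have up_down_o u v :
    {in S &, forall a b, o a b -> [\/ a = u, a = v, b = u | b = v]} ->
    up u v -> dn v u -> dim_le o S 2.
  move=> uvP uv vu; have [euv|nuv] := eqVneq u v.
    by subst; apply: (up_up_o v v).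
  (* If [u] is below [v], a point above [v] would be above [u], hence equal to [v]; so nothing is
     above [v] and the case is up-up. *)
  have [ouv|nouv] := boolP (o u v).
    apply: (up_up_o u v uvP uv) => a aS va.
    have := uv a aS (o_tr _ _ _ ouv va) => e; subst.
    by rewrite o_irr in va.
  apply: (@dim_le2_up_down o S u v) => // a b aS bS ab.
  case: (uvP a b aS bS ab) => e; subst; [|by right|by left|].
    by have e := uv b bS ab; subst; rewrite ab in nouv.
  by have e := vu a aS ab; subst; rewrite ab in nouv.
have oP' : {in S &, forall a b, o a b -> [\/ a = y, a = x, b = y | b = x]}.
  move=> a b aS bS /(oP a b aS bS)[] e;
    [exact: Or42|exact: Or41|exact: Or44|exact: Or43].
have [ux|dx] := up_dn x y oP; have [uy|dy] := up_dn y x oP'.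
- exact: (up_up_o x y).
- exact: (up_down_o x y).
- exact: (up_down_o y x).
pose o' := (fun a b => o b a).
have o'_tr : transitive o' by move=> b a c ba cb; apply: o_tr cb ba.
apply: (@dim_le_dual o'); apply: (up_up o' S x y) => // a b aS bS ba.
case: (oP b a bS aS ba) => e; subst; [by left|by right| right | left].
  exact: dx.
exact: dy.
Qed.

(** * Hiraguchi's bound *)

Section Hiraguchi.
Variable o : rel T.
Hypotheses (o_irr : irreflexive o) (o_tr : transitive o).

(** Each point of [D] beyond two costs one dimension by [dim_le_add1]; an antichain plus two points
    has dimension at most 2. *)
Lemma dim_le_antichainU A D k :
  antichain o A -> #|D| <= k.+2 -> dim_le o (A :|: D) k.+2.
Proof.
move=> /antichainP AP; elim: k D => [|k IHk] D Dk; last first.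
  have [Dk'|Dk'] := leqP #|D| k.+2; first exact: dim_le_mono (IHk D Dk').
  have [x xD] : exists x, x \in D by apply/card_gt0P; apply: leq_trans Dk'.
  have -> : A :|: D = x |: (A :|: D :\ x) by rewrite setUCA setD1K.
  apply: dim_le_add1 => //; apply: IHk.
  by move: Dk; rewrite (cardsD1 x) xD.
have [->|[x0 x0S]] := set_0Vmem (A :|: D).
  by exists (fun _ => height o); split => [t|] x y; rewrite inE.
have [x [y Dxy]] : exists x y, D \subset [set x; y].
  move: Dk; rewrite cardE.
  case eD: (enum D) => [|x [|y [|z s]]] // _.
  - exists x0, x0; apply/subsetP => z; rewrite -mem_enum eD //.
  - by exists x, x; apply/subsetP => z; rewrite -mem_enum eD !inE => ->.
  - by exists x, y; apply/subsetP => z; rewrite -mem_enum eD !inE.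
apply: (@dim_le2_antichain_add2 _ _ x y) => // a b.
have xyP z : z \in A :|: D -> [\/ z \in A, z = x | z = y].
  rewrite inE => /orP[zA|/(subsetP Dxy)]; first exact: Or31.
  by rewrite !inE => /orP[] /eqP ->; [exact: Or32 | exact: Or33].
move=> /xyP[aA|->|->] /xyP[bA|->|->] ab;
  try solve [exact: Or41 | exact: Or42 | exact: Or43 | exact: Or44].
by have := AP a b aA bA; rewrite ab.
Qed.

Lemma hiraguchi n : #|T| <= 2 * n + 1 -> dim_le o [set: T] (maxn 2 n).
Proof.
move=> Tn; have [A [c [_ AP cA cP]]] := dilworth o_irr o_tr [set: T].
have [An|An] := leqP #|A| n.
  apply: (@dim_le_mono _ _ #|A|); first by rewrite leq_max An orbT.
  exact: dim_le_chains cA cP.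
(* With more than [n] of at most [2 * n + 1] points in [A], at most [n] lie outside. *)
rewrite -(setUCr A); have := @dim_le_antichainU A (~: A) (maxn 2 n - 2) AP.
have -> : (maxn 2 n - 2).+2 = maxn 2 n by lia.
by apply; have := cardsC A; lia.
Qed.
End Hiraguchi.
End Dimension.

(** * Alternation by prefix counts, rotations of uniform words, and words made of linear orders *)

Section AlternatingWords.
Set Implicit Arguments.
Unset Strict Implicit.
Variable V : finType.
Implicit Types (x y : V) (w : seq V).

Lemma altwordS x y m : altword x y m.+1 = x :: altword y x m.
Proof.
rewrite /altword /mkseq /=; congr (_ :: _).
rewrite -[1]addn0 iotaDl -map_comp; apply: eq_map => i /=.
by case: (odd i).
Qed.

Lemma restrictC x y w : restrict x y w = restrict y x w.
Proof. by apply: eq_filter => z; rewrite orbC. Qed.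

Lemma alternateC x y w : alternate x y w = alternate y x w.
Proof. by rewrite /alternate restrictC orbC. Qed.

(** Prefix counts turn alternation starting with [x] into arithmetic. *)
Definition leads x y w := forall m,
  count_mem y (take m w) <= count_mem x (take m w) <= (count_mem y (take m w)).+1.

Lemma leadsP x y w : x != y ->
  reflect (leads x y w) (restrict x y w == altword x y (size (restrict x y w))).
Proof.
elim: w x y => [|c w IHw] x y nxy; first by apply: (iffP idP).
rewrite [restrict x y (c :: w)]/restrict /= -/(restrict x y w).
have [ecx|ncx] := eqVneq c x.
  (* After a first [x] the remaining word must be led by [y], so the letters swap roles. *)
  rewrite /= altwordS ecx eqseq_cons eqxx restrictC /=.
  have nyx : y != x by rewrite eq_sym.
  apply: (iffP (IHw y x nyx)) => L m.
    case: m => [|m]; first by rewrite take0.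
    by have := L m; rewrite /= eqxx (negbTE nxy); lia.
  by have := L m.+1; rewrite /= eqxx (negbTE nxy); lia.
have [ecy|ncy] /= := eqVneq c y.
  rewrite altwordS eqseq_cons (negbTE ncx) /=; constructor => /(_ 1) /=.
  by rewrite (negbTE ncx) ecy eqxx take0.
apply: (iffP (IHw x y nxy)) => L m.
  case: m => [|m]; first by rewrite take0.
  by have := L m; rewrite /= (negbTE ncx) (negbTE ncy).
by have := L m.+1; rewrite /= (negbTE ncx) (negbTE ncy).
Qed.

Lemma alternateP x y w : x != y ->
  reflect (leads x y w \/ leads y x w) (alternate x y w).
Proof.
move=> nxy; have nyx : y != x by rewrite eq_sym.
rewrite /alternate /=; apply: (iffP orP).
  by case=> [/leadsP|]; [left | rewrite restrictC => /leadsP; right]; auto.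
by case=> [/leadsP|/leadsP]; [left | rewrite restrictC; right]; auto.
Qed.

Lemma uniform_rot1 k w : uniform k w -> uniform k (rot 1 w).
Proof. by move=> wk x; rewrite -(wk x); apply/permP; rewrite perm_rot. Qed.

(** Moving a leading [x] to the end makes [y] lead; uniformity guarantees that the moved [x] follows
    the last [y]. *)
Lemma alternate_rot1_imp k w x y : uniform k w -> x != y ->
  alternate x y w -> alternate x y (rot 1 w).
Proof.
case: w => [|c w] // wk nxy; rewrite rot1_cons.
wlog: x y nxy / leads x y (c :: w) => [H | L _].
  move=> xyw; case/(alternateP _ nxy): (xyw) => L; first exact: H.
  by rewrite alternateC; apply: H; rewrite // 1?eq_sym 1?alternateC.
have E z m : (c == z) + count_mem z (take m (rcons w c)) =
    if m <= size w then count_mem z (take m.+1 (c :: w)) else (c == z) + k.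
  case: leqP => mw; first by rewrite /= -cats1 takel_cat.
  rewrite take_oversize ?size_rcons // -cats1 count_cat /= -(wk z) /=; lia.
apply/alternateP => //.
have [ecx|ncx] := eqVneq c x.
  right=> m; have := E x m; have := E y m; have := L m.+1.
  rewrite ecx eqxx (negbTE nxy) /= -ecx; case: ifP => _; lia.
have [ecy|ncy] := eqVneq c y.
  by have := L 1; rewrite /= take0 /= (negbTE ncx) ecy eqxx.
left=> m; have := E x m; have := E y m; have := L m.+1.
by rewrite (negbTE ncx) (negbTE ncy) /=; case: ifP => _; lia.
Qed.

Lemma alternate_rot k w n x y : uniform k w -> x != y ->
  alternate x y (rot n w) = alternate x y w.
Proof.
move=> wk nxy.
have it v m : uniform k v -> uniform k (iter m (rot 1) v) /\
    (alternate x y v -> alternate x y (iter m (rot 1) v)).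
  move=> vk; elim: m => [|m [um am]] //=; split; first exact: uniform_rot1.
  by move/am; apply: alternate_rot1_imp um nxy.
have rot_iter (v : seq V) m : m <= size v -> iter m (rot 1) v = rot m v.
  elim: m => [|m IHm] mv; first by rewrite rot0.
  by rewrite iterS (IHm (ltnW mv)) -rotS.
have imp v m : m <= size v -> uniform k v ->
    alternate x y v -> alternate x y (rot m v).
  by move=> mv vk; rewrite -rot_iter //; have [_] := it v m vk.
have [nw|/ltnW nw] := leqP n (size w); last by rewrite rot_oversize.
apply/idP/idP; last exact: imp.
(* For the converse, the complementary rotation restores [w]. *)
rewrite -{2}(rotK n w) /rotr => xyw; apply: imp => //; first by rewrite leq_subr.
by rewrite -(rot_iter _ n nw); have [] := it w n wk.
Qed.

(* [R t x] is the position of the [t]-th [x] after rotating [z] to the front.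
   If the [t]-th [x] always precedes the [t]-th [y], then [x] and [y] alternate,
   because an occurrence of [z] separates the latter from the next [x]. *)
Lemma apex_ranks k w z : uniform k w ->
  (forall x, x != z -> alternate z x w) ->
  exists R : nat -> V -> nat, forall x y, x != z -> y != z -> x != y ->
    alternate x y w <->
    (forall t, t < k -> R t x <= R t y) \/ (forall t, t < k -> R t y <= R t x).
Proof.
move=> wk zP.
have [n rotz] : exists n, k = 0 \/ exists w', rot n w = z :: w'.
  have [->|k0] := eqVneq k 0; first by exists 0; left.
  have /rot_to[n w' e] : z \in w by rewrite -has_pred1 has_count wk lt0n.
  by exists n; right; exists w'.
pose v := rot n w.
have vk : uniform k v by move=> x; rewrite -(wk x); apply/permP; rewrite perm_rot.
have zL x : x != z -> leads z x v.
  move=> xz; have nzx : z != x by rewrite eq_sym.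
  have : alternate z x v by rewrite (alternate_rot n wk nzx) zP.
  case/(alternateP _ nzx) => // L; case: rotz => [k0|[w' e]].
    have v0 : v = [::].
      case: v vk {L} => // a l /(_ a); by rewrite k0 /= eqxx.
    by move=> m; rewrite v0.
  by have := L 1; rewrite /v e /= take0 /= eqxx (negbTE nzx).
have cm x : {homo (fun m => count_mem x (take m v)) : i j / i <= j}.
  move=> i j ij; rewrite -(take_takel v ij) -{2}(cat_take_drop i (take j v)).
  by rewrite count_cat leq_addr.
have ck x m : count_mem x (take m v) <= k.
  by rewrite -(vk x) -{2}(cat_take_drop m v) count_cat leq_addr.
(* [R] is the length of the shortest prefix containing occurrence [t] of [x], counted from 0. *)
have Rex x t : exists R, t < k ->
    forall m, (t < count_mem x (take m v)) = (R <= m).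
  have [tk|] := boolP (t < k); last by exists 0.
  have ex : exists m, t < count_mem x (take m v).
    by exists (size v); rewrite take_size vk.
  case: (ex_minnP ex) => R Rt Rmin; exists R => _ m; apply/idP/idP; first exact: Rmin.
  by move=> Rm; apply: leq_trans Rt (cm x _ _ Rm).
have {Rex} [R RP] : exists R : nat -> V -> nat, forall t x, t < k ->
    forall m, (t < count_mem x (take m v)) = (R t x <= m).
  pose R t x := projT1 (cid (Rex x t)).
  by exists R => t x; rewrite /R; case: cid.
have half x y : x != z -> y != z -> leads x y v <-> (forall t, t < k -> R t x <= R t y).
  move=> xz yz; split=> [L t tk | L m].
    rewrite -RP //; have := L (R t y); have := RP t y tk (R t y).
    by rewrite leqnn; lia.
  (* Both counts equal that of [z] or one less, so they differ by at most one. *)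
  have := zL x xz m; have := zL y yz m.
  suff : count_mem y (take m v) <= count_mem x (take m v) by lia.
  rewrite leqNgt; apply/negP => lt.
  have tk : count_mem x (take m v) < k := leq_trans lt (ck y m).
  have := L _ tk; rewrite (RP _ y tk) in lt => /leq_trans/(_ lt).
  by rewrite -(RP _ x tk) ltnn.
exists R => x y xz yz nxy; rewrite -(alternate_rot n wk nxy).
rewrite -(half x y) // -(half y x) //.
by split=> [/(alternateP _ nxy)|/(alternateP _ nxy)].
Qed.

Lemma flatten_altword (bs : seq (seq V)) x y : x != y ->
  {in bs, forall b, size b = 2} ->
  (flatten bs == altword x y (size (flatten bs))) = all (pred1 [:: x; y]) bs.
Proof.
move=> nxy; elim: bs => [|b bs IHbs] //= bs2.
have := bs2 b (mem_head _ _); case: b bs2 => [|u [|v [|? ?]]] //= bs2 _.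
rewrite !altwordS !eqseq_cons andbT -andbA; congr (_ && (_ && _)).
by apply: IHbs => b bbs; apply: bs2; rewrite inE bbs orbT.
Qed.

Definition rank_word (f : V -> nat) : seq V := sort (relpre f leq) (enum V).

Lemma restrict_rank_word f x y : x != y ->
  size (restrict x y (rank_word f)) = 2 /\
  (f x < f y -> restrict x y (rank_word f) = [:: x; y]).
Proof.
move=> nxy; rewrite /restrict /rank_word filter_sort; last first.
- by move=> a b c; apply: leq_trans.
- by move=> a b; apply: leq_total.
set p := [pred u | (u == x) || (u == y)].
have pe : perm_eq [seq u <- enum V | (u == x) || (u == y)] [:: x; y].
  apply: uniq_perm; first by rewrite filter_uniq ?enum_uniq.
    by rewrite /= inE nxy.
  by move=> u; rewrite mem_filter mem_enum !inE andbT.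
set s := sort _ _.
have sp : perm_eq s [:: x; y] by rewrite perm_sort.
have ss : sorted (relpre f leq) s by apply: sort_sorted => a b; apply: leq_total.
split=> [|xy]; first by rewrite (perm_size sp).
have /= := perm_size sp; have := perm_uniq sp; have := perm_mem sp.
case: s ss {sp} => [|u [|v []]] //= /andP[uv _] m; rewrite !inE nxy !andbT => nuv _.
have := m u; have := m v; rewrite !inE !eqxx orbT /= => /esym vP /esym uP.
case/orP: uP uv nuv => /eqP ->; case/orP: vP => /eqP -> //; rewrite ?eqxx //.
by rewrite leqNgt xy.
Qed.

Lemma flatten_rank_word_uniform (F : nat -> V -> nat) k :
  uniform k (flatten [seq rank_word (F t) | t <- iota 0 k]).
Proof.
move=> x; rewrite count_flatten -map_comp.
rewrite (@eq_map _ _ _ (fun=> 1)) => [|t /=].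
  by rewrite sumnE big_map sum1_size size_iota.
have /permP -> : perm_eq (rank_word (F t)) (enum V) by rewrite perm_sort.
by rewrite count_uniq_mem ?enum_uniq // mem_enum.
Qed.
End AlternatingWords.

(** * Words from realizers, and the lower bound for the cone over the crown *)

Section Comparability.
Set Implicit Arguments.
Unset Strict Implicit.

(** Each block restricts to two letters, so a pair alternates exactly when all blocks list it in the
    same order. *)
Lemma dim_le_representable (G : sgraph) (o : rel G) k :
  0 < k -> orientation o -> transitive o -> dim_le o [set: G] k ->
  k_representable G k.
Proof.
move=> k_gt0 [oE oA] o_tr [F [F1 F2]].
pose bl t := rank_word (F t).
exists (flatten [seq bl t | t <- iota 0 k]); split.
  exact: flatten_rank_word_uniform.
split=> [x | x y nxy].
  by rewrite -has_pred1 has_count flatten_rank_word_uniform.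
pose bs u v := [seq restrict u v (bl t) | t <- iota 0 k].
have rE u v : restrict u v (flatten [seq bl t | t <- iota 0 k]) = flatten (bs u v).
  by rewrite /restrict filter_flatten -map_comp.
have bs2 u v : u != v -> {in bs u v, forall b, size b = 2}.
  by move=> uv b /mapP[t _ ->]; have [] := restrict_rank_word (F t) uv.
have nyx : y != x by rewrite eq_sym.
have alt u v : u != v -> o u v -> all (pred1 [:: u; v]) (bs u v).
  move=> uv ouv; apply/allP => b /mapP[t _ ->] /=; apply/eqP.
  by have [_] := restrict_rank_word (F t) uv; apply; apply: F1; rewrite ?inE.
have nalt u v : u != v -> incomp o u v -> ~~ all (pred1 [:: u; v]) (bs u v).
  move=> uv /and3P[_ ouv ovu]; have vu : v != u by rewrite eq_sym.
  have vu' : incomp o v u by rewrite /incomp vu ovu.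
  have [t tk Ft] := F2 v u (in_setT v) (in_setT u) vu'.
  have bt : restrict u v (bl t) \in bs u v by apply/mapP; exists t; rewrite ?mem_iota.
  apply/negP => /allP/(_ _ bt) /eqP; rewrite restrictC.
  have [_ ->] := restrict_rank_word (F t) vu; last exact: Ft.
  by case=> e; rewrite e eqxx in vu.
rewrite /alternate /= rE flatten_altword //; last exact: bs2.
rewrite -rE restrictC rE flatten_altword //; last exact: bs2.
rewrite oE; have [oxy|oxy] := boolP (o x y); first by rewrite alt.
have [oyx|oyx] := boolP (o y x); first by rewrite (alt y x) // orbT.
have xy : incomp o x y by rewrite /incomp nxy oxy.
have yx : incomp o y x by rewrite /incomp nyx oyx.
by rewrite (negbTE (nalt _ _ nxy xy)) (negbTE (nalt _ _ nyx yx)).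
Qed.

Lemma cone_crown_comparability n : comparability (cone (crown n)).
Proof.
(* The left side is below the right side off the matching, and the apex is on top. *)
exists (fun u v : option ('I_n + 'I_n) => match u, v with
  | Some (inl i), Some (inr j) => i != j
  | Some _, None => true
  | _, _ => false end).
split; first split.
- by move=> [[i|i]|] [[j|j]|] //=; rewrite ?orbF // eq_sym.
- by move=> [[i|i]|] [[j|j]|] //=; rewrite ?andbF.
- by move=> [[i|i]|] [[j|j]|] [[l|l]|] //=.
Qed.

Lemma cone_crown_representable_ge n k :
  0 < n -> k_representable (cone (crown n)) k -> maxn 2 n <= k.
Proof.
move=> n_gt0 [w [wk [_ wE]]].
pose a (i : 'I_n) : cone (crown n) := Some (inl i).
pose b (i : 'I_n) : cone (crown n) := Some (inr i).
pose z : cone (crown n) := None.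
have zP x : x != z -> alternate z x w.
  by move=> xz; rewrite wE 1?eq_sym //; case: x xz.
have [R RP] := apex_ranks wk zP.
have RE x y : x != z -> y != z -> x != y -> edge x y <->
  (forall t, t < k -> R t x <= R t y) \/ (forall t, t < k -> R t y <= R t x).
  by move=> xz yz xy; rewrite -(wE x y xy); apply: RP.
have aa i j : i != j ->
  ~ ((forall t, t < k -> R t (a i) <= R t (a j)) \/
     (forall t, t < k -> R t (a j) <= R t (a i))).
  by move=> ij /(RE (a i) (a j)) H; have := H isT isT ij.
have bb i j : i != j ->
  ~ ((forall t, t < k -> R t (b i) <= R t (b j)) \/
     (forall t, t < k -> R t (b j) <= R t (b i))).
  by move=> ij /(RE (b i) (b j)) H; have := H isT isT ij.
have ab i j : i != j ->
  (forall t, t < k -> R t (a i) <= R t (b j)) \/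
  (forall t, t < k -> R t (b j) <= R t (a i)).
  by move=> ij; apply/(RE (a i) (b j)).
have nab i : ~ ((forall t, t < k -> R t (a i) <= R t (b i)) \/
  (forall t, t < k -> R t (b i) <= R t (a i))).
  by move=> /(RE (a i) (b i)) H; have := H isT isT isT; rewrite /= eqxx.
(* A single rank function would agree with itself on a matched pair and make it adjacent. *)
have k2 : 2 <= k.
  pose i := Ordinal n_gt0; rewrite ltnNge; apply/negP => k1; apply: (nab i).
  case: (leqP (R 0 (a i)) (R 0 (b i))) => [ab0|/ltnW ba0]; [left|right] => t tk.
    by have -> : t = 0 by lia.
  by have -> : t = 0 by lia.
rewrite geq_max k2 /=.
have [n2|n3] := leqP n 2; first exact: leq_trans n2 k2.
pose up i j := `[< forall t, t < k -> R t (a i) <= R t (b j) >].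
have upP i j : reflect (forall t, t < k -> R t (a i) <= R t (b j)) (up i j).
  exact: asboolP.
have upN i j : i != j -> ~~ up i j -> forall t, t < k -> R t (b j) <= R t (a i).
  by move=> ij /upP nup; case: (ab i j ij).
(* Otherwise [b j] lies weakly between [a i] and [a i'] in every rank, which makes these two
   adjacent. *)
have up_r i i' j : i != j -> i' != j -> up i j -> up i' j.
  move=> ij i'j u; have [->//|ii'] := eqVneq i' i.
  apply: contraT => u'; case: (aa i i'); first by rewrite eq_sym.
  by left => t tk; apply: leq_trans (upP _ _ u t tk) (upN _ _ i'j u' t tk).
have up_l i j j' : i != j -> i != j' -> up i j -> up i j'.
  move=> ij ij' u; have [->//|jj'] := eqVneq j' j.
  apply: contraT => u'; case: (bb j j'); first by rewrite eq_sym.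
  by right => t tk; apply: leq_trans (upN _ _ ij' u' t tk) (upP _ _ u t tk).
have third i j : exists l : 'I_n, (l != i) && (l != j).
  have : 0 < #|~: [set i; j]|.
    by have := cardsC [set i; j]; rewrite cards2 card_ord; lia.
  by case/card_gt0P => l; rewrite !inE negb_or; exists l.
(* The direction is carried from [(i, j)] through [(l, j)] and [(l, j')] to [(i', j')]; the index
   [l] exists because [n] is at least 3. *)
have up_all i j i' j' : i != j -> i' != j' -> up i j -> up i' j'.
  move=> ij i'j' u.
  have [l /andP[lj lj']] := third j j'.
  exact: (up_r l i' j' lj' i'j' (up_l l j j' lj lj' (up_r i l j ij lj u))).
(* Each matched pair is reversed at some [t]. Two of them reversed at one [t] would give the cycle
   [q i < p i <= q j < p j <= q i], so [t] determines the pair. *)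
have count_reversals (p q : 'I_n -> cone (crown n)) :
    (forall i j t, i != j -> t < k -> R t (p i) <= R t (q j)) ->
    (forall i, ~ forall t, t < k -> R t (p i) <= R t (q i)) -> n <= k.
  move=> pq qp.
  have /choice[f fP] : forall i, exists t : 'I_k, R t (q i) < R t (p i).
    move=> i; apply: contrapT => nt; apply: (qp i) => t tk.
    by rewrite leqNgt; apply/negP => lt; apply: nt; exists (Ordinal tk).
  suff f_inj : injective f by have := leq_card f f_inj; rewrite !card_ord.
  move=> i j fij; apply/eqP/contraT => ij; have ji : j != i by rewrite eq_sym.
  have := fP i; have := fP j; rewrite -fij.
  by have := pq i j _ ij (ltn_ord (f i)); have := pq j i _ ji (ltn_ord (f i)); lia.
have [/existsP[i /existsP[j /andP[ij u]]]|no_up] :=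
  boolP [exists i, exists j, (i != j) && up i j].
  apply: (count_reversals a b) => [i' j' t i'j' tk|i' H]; last by apply: (nab i'); left.
  exact: (upP _ _ (up_all i j i' j' ij i'j' u)).
apply: (count_reversals b a) => [j i t ji tk|i H]; last by apply: (nab i); right.
have ij : i != j by rewrite eq_sym.
apply: (upN i j ij) => //; apply: contra no_up => u.
by apply/existsP; exists i; apply/existsP; exists j; rewrite ij.
Qed.
End Comparability.

Theorem theorem6 (n : nat) (n_gt0 : 1 <= n) :
  comparability (cone (crown n)) /\
  (forall G : sgraph, comparability G -> #|G| = 2 * n + 1 ->
     le_repnum (repnum G) (repnum (cone (crown n)))).
Proof.
split=> [|G [o [oo o_tr]] Gn]; first exact: cone_crown_comparability.
have o_irr : irreflexive o.
  by move=> x; case: oo => _ /(_ x x); rewrite andbb => /negbTE.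
have GE : #|G| <= 2 * n + 1 by rewrite Gn.
have max_gt0 : 0 < maxn 2 n by rewrite leq_max.
have Gmax := dim_le_representable max_gt0 oo o_tr (hiraguchi o_irr o_tr GE).
(* The value [maxn 2 n] is attained for [G] and bounds every [l] for the cone from below. *)
rewrite /repnum; case: pselect => [Gk|nGk]; last by case: nGk; exists (maxn 2 n).
case: pselect => [Ck|//] /=.
case: ex_minnP => g _ gmin; case: ex_minnP => l /andP[_ /asboolP Cl] _.
apply: leq_trans (gmin _ _) (cone_crown_representable_ge n_gt0 Cl).
by rewrite max_gt0; apply/asboolP.
Qed.
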